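(* Let $\lambda,\mu_1,\mu_2>0$ with $\lambda<\min\{\mu_1,\mu_2\}$. For $m=1,2,\dots$ let $R_m$ be the $R$-matrix of the tandem Jackson network in which the first queue has finite capacity $m$, and let $r_m$ be the Perron–Frobenius eigenvalue of $R_m$. Put $\rho_2=\lambda/\mu_2$ and let $\eta\in(0,1)$ be the unique zero in $(0,1)$ of $\tau(z)=-\lambda-\mu_1-\mu_2(1-z)+2\sqrt{\lambda\mu_1/z}$. If $\mu_1\le\mu_2$, then the sequence $r_1,r_2,\dots$ strictly increases to $\eta$. If $\mu_1>\mu_2$, then the sequence $r_1,r_2,\dots$ strictly increases to $\rho_2$.
   Context: The tandem Jackson network with capacity $m<\infty$ at the first queue (customers finding the first queue full are rejected) is the continuous-time Markov chain $(Y_t,J_t)$ on $\{0,1,\dots\}\times\{0,\dots,m\}$, where $Y_t$ (level) is the number in queue 2 and $J_t$ (phase) the number in queue 1, with transitions $(k,j)\to(k,j+1)$ at rate $\lambda$ for $j<m$; $(k,j)\to(k+1,j-1)$ at rate $\mu_1$ for $j\ge1$; $(k,j)\to(k-1,j)$ at rate $\mu_2$ for $k\ge1$. The $(m+1)\times(m+1)$ blocks of its generator are: $Q_0(j,j-1)=\mu_1$ ($1\le j\le m$), other entries $0$; $Q_1(j,j+1)=\lambda$ ($0\le j<m$), $Q_1(0,0)=-(\lambda+\mu_2)$, $Q_1(j,j)=-(\lambda+\mu_1+\mu_2)$ ($1\le j\le m-1$), $Q_1(m,m)=-(\mu_1+\mu_2)$, other entries $0$; $Q_2=\mu_2I$.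 $R_m$ is the minimal nonnegative solution of $Q_0+RQ_1+R^2Q_2=0$. Its Perron–Frobenius eigenvalue is its largest nonnegative eigenvalue, equal to its spectral radius. *)

(* Defs.v *)
From HB Require Import structures.
From mathcomp Require Import all_boot all_order all_algebra.
From mathcomp Require Import all_classical all_reals all_analysis.

Set Implicit Arguments.
Unset Strict Implicit.
Unset Printing Implicit Defensive.

Import Order.TTheory GRing.Theory Num.Theory.
Import numFieldNormedType.Exports.

Local Open Scope ring_scope.

(* Generator blocks of the tandem Jackson network whose first queue has
   capacity m >= 1.  Level = number in queue 2, phase = number in queue 1, so
   phases are 'I_m.+1; Q0 raises the level, Q1 keeps it, Q2 lowers it. *)

Definition tandem_Q0 (R : realType) (mu1 : R) (m : nat) : 'M[R]_m.+1 :=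
  \matrix_(i < m.+1, j < m.+1) if (i == j.+1 :> nat) then mu1 else 0.

Definition tandem_Q1 (R : realType) (lam mu1 mu2 : R) (m : nat) :
    'M[R]_m.+1 :=
  \matrix_(i < m.+1, j < m.+1)
    if (j == i.+1 :> nat) then lam
    else if (i == j :> nat) then
      if (i == 0%N :> nat) then - (lam + mu2)
      else if (i == m :> nat) then - (mu1 + mu2)
      else - (lam + mu1 + mu2)
    else 0.

Definition tandem_Q2 (R : realType) (mu2 : R) (m : nat) : 'M[R]_m.+1 :=
  mu2%:M.

Definition nonneg_solution (R : realType) (n : nat)
    (Q0 Q1 Q2 X : 'M[R]_n.+1) : Prop :=
  (forall i j, 0 <= X i j) /\ Q0 + X *m Q1 + X ^+ 2 *m Q2 = 0.

(* Minimality is for the entrywise order: X lies below every nonnegative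
   solution, hence is unique. *)
Definition minimal_nonneg_solution (R : realType) (n : nat)
    (Q0 Q1 Q2 X : 'M[R]_n.+1) : Prop :=
  nonneg_solution Q0 Q1 Q2 X /\
  forall Y, nonneg_solution Q0 Q1 Q2 Y -> forall i j, X i j <= Y i j.

Definition is_tandem_R (R : realType) (lam mu1 mu2 : R) (m : nat)
    (X : 'M[R]_m.+1) : Prop :=
  minimal_nonneg_solution (tandem_Q0 mu1 m) (tandem_Q1 lam mu1 mu2 m)
    (tandem_Q2 mu2 m) X.

(* The largest nonnegative eigenvalue; for an entrywise nonnegative matrix it
   exists and equals the spectral radius. *)
Definition is_PF_eigenvalue (R : realType) (n : nat) (A : 'M[R]_n) (r : R) :
    Prop :=
  [/\ 0 <= r, eigenvalue A r
    & forall s : R, 0 <= s -> eigenvalue A s -> s <= r].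

Definition tau (R : realType) (lam mu1 mu2 z : R) : R :=
  - lam - mu1 - mu2 * (1 - z) + 2 * Num.sqrt (lam * mu1 / z).

(* Main.v *)
Require Import Defs.
From HB Require Import structures.
From mathcomp Require Import all_boot all_order all_algebra.
From mathcomp Require Import all_classical all_reals all_analysis.
From mathcomp Require Import ring lra zify.

Set Implicit Arguments.
Unset Strict Implicit.
Unset Printing Implicit Defensive.

Import Order.TTheory GRing.Theory Num.Theory.
Import numFieldNormedType.Exports.

Local Open Scope classical_set_scope.
Local Open Scope ring_scope.

(** Write Q(z) for Q0 + z Q1 + z^2 Q2.  A row eigenvector of R_m for the
    eigenvalue z satisfies x Q(z) = 0.  The proof rests on a converse: if
    0 < z < 1 and some entrywise positive x satisfies x Q(z) = 0, then z is the
    Perron-Frobenius eigenvalue of R_m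
    ([PF_eigenvalue_of_positive_kernel]).  The minimal solution is the limit of a monotone iteration from 0,
    along which x Y <= z x is preserved, so x R_m <= z x, and pairing with x
    bounds every nonnegative eigenvalue by z.  Equality x R_m = z x follows
    because the nonnegative defect y = z x - x R_m is killed by
    Q1 + R_m Q2 + z Q2, whose row sums are (z - 1) times those of Q2.

    For the tandem network, x Q(z) = 0 is a three-term recurrence in the phase.
    Starting from x_0 = 1 it determines x_j(z) for all j, with the same
    polynomials for every capacity m; the capacity only enters through the last
    equation, B_m(z) = mu1 x_{m+1}(z) - z lam x_m(z) = 0.  Hence r_m is
    the point z where x_0, ..., x_m > 0 and B_m = 0.  Such a point is
    found by the intermediate value theorem applied to the minimum M_m of
    x_0, ..., x_m and B_m: at a zero of M_m no x_j can vanish, since the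
    recurrence would make x_{j+1} negative, so it is B_m that vanishes
    ([margin_root]).

    Let c be the claimed limit, eta or lam / mu2.  Three facts then finish the
    proof.  First, M_m(c) > 0 for every m, because a geometric sequence is a
    lower solution of the recurrence at c ([margin_gt0]).  Second, at a zero
    z < c of B_m one has B_{m+1}(z) < 0 ([boundary_succ_lt0]), so the zero for
    capacity m + 1 lies in (z, c): the sequence r_m strictly increases and
    stays below c.  Third, for z < c close to c some x_k(z) is nonpositive,
    because the ratios x_{j+1}(z) / x_j(z) would otherwise decrease by a fixed
    amount at every step ([phase_le0]); then M_k(z) <= 0 and z <= r_k < c.

    The two regimes come from the quadratic mu1 w^2 - z S w + z lam that
    governs the ratios, S = lam + mu1 + mu2 (1 - z).  Its discriminant is
    negative exactly when tau(z) > 0, that is when z < eta; this blocks every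
    starting ratio.  When mu1 > mu2 the initial ratio x_1 / x_0 lies to the
    left of the smaller root even for z between eta and lam / mu2, and meets
    that root at z = lam / mu2, so the limit is lam / mu2 instead. *)

(** * Entrywise order on matrices *)

Definition le_mx (R : numDomainType) m n (A B : 'M[R]_(m, n)) : Prop :=
  forall i j, A i j <= B i j.

Lemma le_mx_mul (R : numDomainType) m n p (A B : 'M[R]_(m, n))
    (C D : 'M[R]_(n, p)) :
  le_mx 0 A -> le_mx A B -> le_mx 0 C -> le_mx C D ->
  le_mx (A *m C) (B *m D).
Proof.
move=> A0 AB C0 CD i j; rewrite !mxE; apply: ler_sum => k _.
by apply: ler_pM => //; [have := A0 i k | have := C0 k j]; rewrite mxE.
Qed.

Lemma mulmx_ge0 (R : numDomainType) m n p (A : 'M[R]_(m, n))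
    (C : 'M[R]_(n, p)) :
  le_mx 0 A -> le_mx 0 C -> le_mx 0 (A *m C).
Proof.
move=> A0 C0; rewrite -(mul0mx m C); apply: le_mx_mul => // i j.
Qed.

(** * Minimal solutions of the matrix quadratic equation *)

Section RateMatrix.
Variables (R : realType) (n : nat) (Q0 Q1 Q2 : 'M[R]_n.+1).
Hypotheses (Q0_ge0 : le_mx 0 Q0) (Q2_ge0 : le_mx 0 Q2).
Hypothesis Q1_offdiag : forall i j, i != j -> 0 <= Q1 i j.

(* Any c making Q1 + c I nonnegative serves as a uniformization rate. *)
Let c := 1 + \sum_i `|Q1 i i|.

Let c_gt0 : 0 < c.
Proof. by rewrite ltr_wpDr// sumr_ge0. Qed.

Let P := Q1 + c%:M.

Let P_ge0 : le_mx 0 P.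
Proof.
move=> i j; rewrite !mxE; have [<-|ij] := eqVneq i j; last first.
  by rewrite mulr0n addr0 Q1_offdiag.
rewrite mulr1n /c (bigD1 i)//=.
have : - `|Q1 i i| <= Q1 i i by rewrite lerNl -normrN ler_norm.
have : 0 <= \sum_(k | k != i) `|Q1 k k| by rewrite sumr_ge0.
lra.
Qed.

(** The quadratic equation rewritten as a fixed-point equation by
    uniformization: adding c Y to both sides leaves only nonnegative
    coefficients, so the step is monotone, and no inverse of Q1 is taken. *)
Definition rate_step (Y : 'M[R]_n.+1) :=
  c^-1 *: (Q0 + Y *m P + Y *m Y *m Q2).

Lemma rate_step_fixed Y :
  rate_step Y = Y <-> Q0 + Y *m Q1 + Y ^+ 2 *m Q2 = 0.
Proof.
have c0 : c != 0 by rewrite gt_eqF.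
have E : Q0 + Y *m P + Y *m Y *m Q2
       = (Q0 + Y *m Q1 + Y ^+ 2 *m Q2) + c *: Y.
  rewrite expr2 -mulmxE mulmxDr mul_mx_scalar -!addrA; congr (_ + (_ + _)).
  by rewrite addrC.
rewrite /rate_step E scalerDr scalerA mulVf// scale1r; split => [/eqP|->].
  by rewrite -subr_eq0 addrK scaler_eq0 invr_eq0 (negPf c0) => /eqP.
by rewrite scaler0 add0r.
Qed.

Lemma rate_step_mono A B :
  le_mx 0 A -> le_mx A B -> le_mx (rate_step A) (rate_step B).
Proof.
move=> A0 AB i j; rewrite mxE [leRHS]mxE ler_pM2l ?invr_gt0//.
rewrite mxE [leRHS]mxE; apply: lerD.
  by rewrite mxE [leRHS]mxE lerD2l; apply: le_mx_mul.
by apply: le_mx_mul => //; [exact: mulmx_ge0 | exact: le_mx_mul].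
Qed.

Lemma rate_step0_ge0 : le_mx 0 (rate_step 0).
Proof.
move=> i j; rewrite /rate_step !mul0mx !addr0 !mxE.
rewrite mulr_ge0 ?invr_ge0 ?(ltW c_gt0)//.
by have := Q0_ge0 i j; rewrite mxE.
Qed.

Let Y k := iter k rate_step 0.

Let Y_ge0 k : le_mx 0 (Y k).
Proof.
elim: k => [|k IH] i j //=.
exact: le_trans (rate_step0_ge0 i j) (rate_step_mono (fun _ _ => lexx _) IH i j).
Qed.

Let Y_nondecreasing i j : nondecreasing_seq (fun k => Y k i j).
Proof.
apply/nondecreasing_seqP => k; elim: k i j => [|k IH] i j.
  exact: rate_step0_ge0.
exact: rate_step_mono (Y_ge0 k) IH i j.
Qed.

Let Y_le X k : le_mx 0 X -> Q0 + X *m Q1 + X ^+ 2 *m Q2 = 0 -> le_mx (Y k) X.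
Proof.
move=> X0 /rate_step_fixed EX; elim: k => //= k IH; rewrite -EX.
exact: rate_step_mono (Y_ge0 k) IH.
Qed.

(** The iterates from 0 increase and stay below every nonnegative solution;
    their limit is a fixed point of the step, hence a nonnegative solution
    below X, and minimality makes it X. *)
Lemma minimal_nonneg_solution_cvg X :
  minimal_nonneg_solution Q0 Q1 Q2 X ->
  forall i j, (fun k => iter k rate_step 0 i j) @ \oo --> X i j.
Proof.
case=> -[X0' solX minX].
have X0 : le_mx 0 X by move=> i j; rewrite mxE.
have Ycvg i j : cvgn (fun k => Y k i j).
  apply: nondecreasing_is_cvgn => //.
  by exists (X i j) => _ [k _ <-]; exact: Y_le.
pose L : 'M[R]_n.+1 := \matrix_(i, j) limn (fun k => Y k i j).
have YL i j : (fun k => Y k i j) @ \oo --> L i j by rewrite mxE; exact: Ycvg.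
have LX i j : L i j <= X i j.
  by rewrite mxE; apply: limr_le => //; near=> k; exact: Y_le.
have L0 i j : 0 <= L i j.
  rewrite mxE; apply: limr_ge => //; near=> k.
  by have := Y_ge0 k i j; rewrite mxE.
have mul_cvg (A B : nat -> 'M[R]_n.+1) (A' B' : 'M[R]_n.+1) :
    (forall i j, (fun k => A k i j) @ \oo --> A' i j) ->
    (forall i j, (fun k => B k i j) @ \oo --> B' i j) ->
    forall i j, (fun k => (A k *m B k) i j) @ \oo --> (A' *m B') i j.
  move=> HA HB i j; rewrite mxE.
  under eq_fun do rewrite mxE.
  by apply: cvg_big => [|l _]; [exact: add_continuous | apply: cvgM].
have stepL : rate_step L = L.
  have cst (A : 'M[R]_n.+1) i j : (fun k : nat => A i j) @ \oo --> A i j.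
    exact: cvg_cst.
  apply/matrixP => i j.
  have cvg1 : (fun k => Y k.+1 i j) @ \oo --> L i j.
    by have := YL i j; rewrite -cvg_shiftS.
  apply/esym/(cvg_unique _ cvg1) => //=.
  rewrite /rate_step !mxE.
  under eq_fun do rewrite !mxE.
  apply: cvgM; first exact: cvg_cst.
  apply: cvgD.
    apply: cvgD; first exact: cvg_cst.
    by have := mul_cvg _ _ _ _ YL (cst P) i j; rewrite mxE;
       under eq_fun do rewrite mxE.
  have := mul_cvg _ _ _ _ (mul_cvg _ _ _ _ YL YL) (cst Q2) i j.
  by rewrite mxE; under eq_fun do rewrite mxE.
have -> : X = L; last exact: YL.
apply/matrixP => i j; apply/le_anti; rewrite LX andbT; apply: minX.
by split=> //; apply/rate_step_fixed.
Unshelve. all: by end_near.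
Qed.

(** A nonnegative x in the left kernel of Q(z) satisfies x Y <= z x for Y = 0, and
    the uniformized step preserves this inequality, so it passes to the limit. *)
Lemma minimal_solution_subinvariant X (x : 'rV[R]_n.+1) (z : R) :
  minimal_nonneg_solution Q0 Q1 Q2 X -> 0 <= z -> le_mx 0 x ->
  x *m (Q0 + z *: Q1 + z ^+ 2 *: Q2) = 0 ->
  le_mx (x *m X) (z *: x).
Proof.
move=> minX z0 x0 xQ.
have le_xY k : le_mx (x *m Y k) (z *: x).
  elim: k => [|k IH] /=.
    by move=> i j; rewrite mulmx0 !mxE mulr_ge0//; have := x0 i j; rewrite mxE.
  have -> : z *: x = c^-1 *: (x *m Q0 + z *: x *m P + z *: (z *: x) *m Q2).
    have E := xQ; rewrite !mulmxDr -!scalemxAr in E.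
    rewrite mulmxDr mul_mx_scalar -!scalemxAl [z *: (z *: (x *m Q2))]scalerA.
    rewrite addrA [X in _ = _ *: X]addrAC -expr2 E add0r.
    by rewrite scalerA mulVf ?scale1r// gt_eqF.
  rewrite /rate_step -scalemxAr => i j; rewrite mxE [leRHS]mxE.
  rewrite ler_pM2l ?invr_gt0// !(mulmxDr x) !mulmxA.
  have xY0 : le_mx 0 (x *m Y k) by exact: mulmx_ge0.
  rewrite mxE [leRHS]mxE lerD//.
    by rewrite mxE [leRHS]mxE lerD2l; apply: le_mx_mul.
  apply: le_mx_mul => //; first exact: mulmx_ge0.
  move=> i' j'; apply: le_trans (_ : ((z *: x) *m Y k) i' j' <= _).
    by apply: le_mx_mul => // ? ?.
  by rewrite -scalemxAl mxE [leRHS]mxE ler_wpM2l.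
move=> i j; rewrite mxE.
have xX : (fun k => \sum_l x i l * Y k l j) @ \oo --> \sum_l x i l * X l j.
  apply: cvg_big => [|l _]; first exact: add_continuous.
  by apply: cvgM; [exact: cvg_cst | exact: minimal_nonneg_solution_cvg].
rewrite -(cvg_lim _ xX)//; apply: limr_le.
  by apply/cvg_ex; exists (\sum_l x i l * X l j).
by near=> k; have := le_xY k i j; rewrite mxE.
Unshelve. all: by end_near.
Qed.
End RateMatrix.

(** * Perron-Frobenius eigenvalue of the minimal solution *)

Lemma le_mx_norm_mul (R : numDomainType) m n p (A : 'M[R]_(m, n))
    (w : 'M[R]_(n, p)) :
  le_mx 0 A -> le_mx (map_mx Num.norm (A *m w)) (A *m map_mx Num.norm w).
Proof.
move=> A0 i j; rewrite !mxE (le_trans (ler_norm_sum _ _ _))//.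
apply: ler_sum => k _; rewrite normrM mxE ger0_norm//.
by have := A0 i k; rewrite mxE.
Qed.

(** Pair x with the absolute value of a right eigenvector w:
    s x|w| <= x A|w| <= z x|w|, and x|w| > 0. *)
Lemma subinvariant_eigenvalue_le (R : numFieldType) n (A : 'M[R]_n)
    (x : 'rV[R]_n) (w : 'cV[R]_n) (z s : R) :
  le_mx 0 A -> (forall j, 0 < x 0 j) -> le_mx (x *m A) (z *: x) ->
  0 <= s -> w != 0 -> A *m w = s *: w -> s <= z.
Proof.
move=> A0 x0 xA s0 w0 Aw; pose v := map_mx Num.norm w.
have x_ge0 : le_mx 0 x by move=> i j; rewrite ord1 mxE ltW.
have v0 : le_mx 0 v by move=> i j; rewrite !mxE.
have xv : 0 < (x *m v) 0 0.
  rewrite mxE lt_neqAle sumr_ge0 ?andbT; last first.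
    by move=> k _; rewrite mxE mulr_ge0 ?normr_ge0 ?(ltW (x0 _)).
  rewrite eq_sym psumr_neq0 => [|k _]; last first.
    by rewrite mxE mulr_ge0 ?normr_ge0 ?(ltW (x0 _)).
  have /matrix0Pn[k [j wkj]] := w0.
  by apply/hasP; exists k; rewrite ?mem_index_enum//= mulr_gt0//
     mxE normr_gt0 -(ord1 j).
rewrite -(ler_pM2r xv).
have -> : s * (x *m v) 0 0 = (x *m (s *: v)) 0 0 by rewrite -scalemxAr [RHS]mxE.
have -> : z * (x *m v) 0 0 = (z *: x *m v) 0 0 by rewrite -scalemxAl [RHS]mxE.
have svE : s *: v = map_mx Num.norm (A *m w).
  by apply/matrixP => i j; rewrite Aw !mxE normrM ger0_norm.
apply: (@le_trans _ _ ((x *m A *m v) 0 0)).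
  rewrite -mulmxA; apply: le_mx_mul => //; last first.
    by rewrite svE; exact: le_mx_norm_mul.
  by move=> i j; rewrite !mxE mulr_ge0.
by apply: le_mx_mul => //; exact: mulmx_ge0.
Qed.

Lemma eigenvalue_trmx (F : fieldType) n (A : 'M[F]_n) s :
  eigenvalue A^T s = eigenvalue A s.
Proof.
rewrite !eigenvalue_root_char /char_poly -[in RHS]det_tr.
by rewrite /char_poly_mx linearB/= tr_scalar_mx map_trmx.
Qed.

(** Existence of a positive vector in the left kernel of Q(z), z < 1, forces z
    to be the largest nonnegative eigenvalue.  The factorization
    Q(z) = (z - X) (Q1 + X Q2 + z Q2) turns x Q(z) = 0 into
    y (Q1 + X Q2 + z Q2) = 0 for the defect y = z x - x X >= 0, and the row sums
    of the second factor are negative, which leaves only y = 0. *)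
Theorem PF_eigenvalue_of_positive_kernel (R : realType) n
    (Q0 Q1 Q2 X : 'M[R]_n.+1) (x : 'rV[R]_n.+1) (z r : R) :
  le_mx 0 Q0 -> le_mx 0 Q2 -> (forall i j, i != j -> 0 <= Q1 i j) ->
  (Q0 + Q1 + Q2) *m const_mx 1 = 0 :> 'cV_n.+1 ->
  (forall i, 0 < (Q2 *m const_mx 1 : 'cV_n.+1) i 0) ->
  0 < z < 1 -> (forall j, 0 < x 0 j) ->
  x *m (Q0 + z *: Q1 + z ^+ 2 *: Q2) = 0 ->
  minimal_nonneg_solution Q0 Q1 Q2 X -> is_PF_eigenvalue X r -> r = z.
Proof.
move=> Q0_ge0 Q2_ge0 Q1_off gen Q2_row /andP[z0 z1] x0 xQ minX [r0 eig_r r_max].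
have [[X0' solX] _] := minX.
have X0 : le_mx 0 X by move=> i j; rewrite mxE.
have x_ge0 : le_mx 0 x by move=> i j; rewrite ord1 mxE ltW.
have xX : le_mx (x *m X) (z *: x).
  exact: minimal_solution_subinvariant (ltW z0) x_ge0 xQ.
pose e : 'cV[R]_n.+1 := const_mx 1.
(* Up and down crossings of a level balance.  Applied to e, the quadratic
   equation says that X fixes the difference of the two sides, and 1 > z is no
   eigenvalue of X. *)
have flow : X *m Q2 *m e = Q0 *m e.
  apply/eqP; rewrite -subr_eq0; apply/negPn/negP => ne.
  have : (1 : R) <= z.
    apply: (@subinvariant_eigenvalue_le _ _ X x
      (X *m Q2 *m e - Q0 *m e)) => //.
    rewrite scale1r.
    have Q1e : Q1 *m e = - (Q0 *m e + Q2 *m e).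
      apply/eqP; rewrite -addr_eq0 -!mulmxDl addrA [Q1 + Q0]addrC.
      exact/eqP.
    have := congr1 (mulmx^~ e) solX.
    rewrite expr2 -mulmxE mul0mx !mulmxDl -!mulmxA Q1e mulmxN !mulmxDr mulmxN.
    move/eqP; rewrite opprD !addrA.
    move=> /eqP E; apply/eqP; rewrite -subr_eq0 -E; apply/eqP.
    by rewrite opprB !addrA; apply/matrixP => i j; rewrite !mxE; ring.
  by rewrite leNgt z1.
pose y := z *: x - x *m X.
have y_ge0 i : 0 <= y 0 i.
  by have := xX 0 i; rewrite !mxE subr_ge0.
have yU : y *m (Q1 + X *m Q2 + z *: Q2) = 0.
  rewrite -xQ; have -> : Q0 = - (X *m Q1 + X *m X *m Q2).
    apply/eqP; rewrite -addr_eq0 addrA; apply/eqP.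
    by rewrite -[RHS]solX expr2 -mulmxE.
  rewrite /y mulmxBl !mulmxDr mulmxN !mulmxDr.
  rewrite -!scalemxAl -!scalemxAr !scalerA -!mulmxA.
  by apply/matrixP => i j; rewrite !mxE; ring.
have Ue : (Q1 + X *m Q2 + z *: Q2) *m e = (z - 1) *: (Q2 *m e).
  rewrite !mulmxDl flow; have := gen; rewrite !mulmxDl -/e -scalemxAl => E.
  rewrite scalerBl scale1r -[RHS]add0r -E.
  by apply/matrixP => i j; rewrite !mxE; ring.
have yQ2e : y *m (Q2 *m e) = 0.
  have /eqP := congr1 (mulmx^~ e) yU.
  rewrite -mulmxA Ue mul0mx -scalemxAr scaler_eq0 subr_eq0 lt_eqF//=.
  by move/eqP.
have y_eq0 : y = 0.
  apply/matrixP => i j; rewrite ord1 [RHS]mxE.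
  have /matrixP/(_ 0 0) := yQ2e; rewrite mxE [RHS]mxE => /eqP.
  rewrite psumr_eq0 => [/allP/(_ j (mem_index_enum j))|k _]; last first.
    by rewrite mulr_ge0// ltW.
  by rewrite /= mulf_eq0 [X in _ || X]gt_eqF// orbF => /eqP.
apply/le_anti/andP; split.
  (* Eigenvalues are defined by row eigenvectors, the bound by columns. *)
  move: eig_r; rewrite -eigenvalue_trmx.
  case/eigenvalueP => v vX v0.
  apply: (@subinvariant_eigenvalue_le _ _ X x v^T) => //.
    by rewrite -trmx0 (inj_eq trmx_inj).
  by apply: trmx_inj; rewrite trmx_mul trmxK vX linearZ/= trmxK.
apply: r_max; first exact: ltW.
apply/eigenvalueP; exists x.
  by apply/esym/eqP; rewrite -subr_eq0; apply/eqP.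
by apply/matrix0Pn; exists 0, 0; rewrite gt_eqF.
Qed.

(** * The phase recurrence of the tandem network *)

Section Tandem.
Variables (R : realType) (lam mu1 mu2 : R).
Hypotheses (lam_gt0 : 0 < lam) (mu1_gt0 : 0 < mu1) (mu2_gt0 : 0 < mu2).

(** Minus the diagonal entry of Q1 + z Q2 at an interior phase. *)
Definition out_rate (z : R) : R := lam + mu1 + mu2 * (1 - z).

(** The solution of x Q(z) = 0 from x_0 = 1, column by column; the capacity is
    absent because it changes only the last column. *)
Fixpoint phase (z : R) (j : nat) : R :=
  match j with
  | 0 => 1
  | 1 => z * (out_rate z - mu1) / mu1
  | (k.+1 as k').+1 => (z * out_rate z * phase z k' - z * lam * phase z k) / mu1
  end.

(** Minus the last column of x Q(z), rewritten with the interior recurrence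
    that defines x_{m+1}. *)
Definition boundary (m : nat) (z : R) : R :=
  mu1 * phase z m.+1 - z * lam * phase z m.

Lemma phaseSS (z : R) k :
  mu1 * phase z k.+2 = z * out_rate z * phase z k.+1 - z * lam * phase z k.
Proof. by rewrite /= mulrC divfK// gt_eqF. Qed.

Lemma phase1 (z : R) : mu1 * phase z 1 = z * (lam + mu2 * (1 - z)).
Proof. by rewrite /= mulrC divfK ?gt_eqF// /out_rate; ring. Qed.

Lemma sum_ord_pick n (G : nat -> R) k :
  \sum_(i < n) (if i == k :> nat then G i else 0)
  = if (k < n)%N then G k else 0.
Proof. by rewrite -big_mkcond big_ord1_eq. Qed.

Lemma tandem_kernel m (z : R) : (1 <= m)%N -> boundary m z = 0 ->
  \row_(j < m.+1) phase z j *m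
    (tandem_Q0 mu1 m + z *: tandem_Q1 lam mu1 mu2 m + z ^+ 2 *: tandem_Q2 mu2 m)
  = 0.
Proof.
move=> m1 bd; apply/matrixP => i0 j; rewrite mxE [RHS]mxE.
pose D := z * (if (j == 0 :> nat)%N then - (lam + mu2)
      else if (j == m :> nat) then - (mu1 + mu2)
      else - (lam + mu1 + mu2)) + z ^+ 2 * mu2.
(* Column j of Q(z) as a sum of three one-entry columns. *)
transitivity (\sum_(i < m.+1)
   ((if i == j.+1 :> nat then phase z i * mu1 else 0) +
    (if i == j.-1 :> nat then
       phase z i * (if (0 < j)%N then z * lam else 0) else 0) +
    (if i == j :> nat then phase z i * D else 0))).
  apply: eq_bigr => i _; rewrite !mxE /D -[i == j]/(i == j :> nat).
  have [Ej|/eqP nj] := eqVneq (i : nat) j.+1.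
    rewrite (_ : (j == i.+1 :> nat) = false); last by lia.
    rewrite (_ : (i == j :> nat) = false); last by lia.
    rewrite (_ : (i == j.-1 :> nat) = false); last by lia.
    by rewrite mulr0n; ring.
  have [Ei|/eqP ni] := eqVneq (j : nat) i.+1.
    rewrite (_ : (i == j :> nat) = false); last by lia.
    rewrite (_ : (i == j.-1 :> nat)); last by lia.
    rewrite (_ : (0 < j)%N); last by lia.
    by rewrite mulr0n; ring.
  have [Ei|/eqP nij] := eqVneq (i : nat) j.
    rewrite Ei mulr1n; have [E|/eqP E] := eqVneq (j : nat) j.-1; last by ring.
    by rewrite (_ : (0 < j)%N = false); [ring | lia].
  rewrite (_ : (i == j.-1 :> nat) = false); last by lia.
  by rewrite mulr0n; ring.
rewrite !big_split/= (sum_ord_pick _ (fun i => phase z i * mu1)).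
rewrite (sum_ord_pick _
  (fun i => phase z i * (if (0 < j)%N then z * lam else 0))).
rewrite (sum_ord_pick _ (fun i => phase z i * D)) ltn_ord /D.
have jm : (j < m.+1)%N by [].
rewrite (_ : (j.-1 < m.+1)%N); last by lia.
have := phaseSS z j.-1; rewrite /boundary in bd.
case: (nat_of_ord j) jm => [|k] km /=.
  rewrite (_ : (1 < m.+1)%N)// => _; rewrite /out_rate; field; exact: lt0r_neq0.
rewrite ltnS -/(phase z k.+1) -/(phase z k.+2) => rec.
have [Ek|/eqP nk] := eqVneq k.+1 m.
  move: bd; rewrite -Ek ltnn => bd.
  have -> : phase z k * (z * lam)
      = z * out_rate z * phase z k.+1 - mu1 * phase z k.+2.
    by rewrite rec; ring.
  have -> : mu1 * phase z k.+2 = z * lam * phase z k.+1.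
    by apply/eqP; rewrite -subr_eq0 bd.
  by rewrite /out_rate; ring.
rewrite (_ : (k.+1 < m)%N); last by lia.
by rewrite [phase z k.+2 * mu1]mulrC rec /out_rate; ring.
Qed.

Lemma tandem_generator m : (1 <= m)%N ->
  (tandem_Q0 mu1 m + tandem_Q1 lam mu1 mu2 m + tandem_Q2 mu2 m) *m const_mx 1
  = 0 :> 'cV_m.+1.
Proof.
move=> m1; apply/matrixP => i i0; rewrite mxE [RHS]mxE.
pose D := (if (i == 0 :> nat)%N then - (lam + mu2)
      else if (i == m :> nat) then - (mu1 + mu2)
      else - (lam + mu1 + mu2)) + mu2.
transitivity (\sum_(j < m.+1)
   ((if j == i.-1 :> nat then (if (0 < i)%N then mu1 else 0) else 0) +
    (if j == i.+1 :> nat then lam else 0) +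
    (if j == i :> nat then D else 0))).
  apply: eq_bigr => j _; rewrite !mxE /D -[i == j]/(i == j :> nat).
  have [Ej|/eqP nj] := eqVneq (i : nat) j.+1.
    rewrite (_ : (j == i.+1 :> nat) = false); last by lia.
    rewrite (_ : (i == j :> nat) = false); last by lia.
    rewrite (_ : (j == i :> nat) = false); last by lia.
    rewrite (_ : (j == i.-1 :> nat)); last by lia.
    rewrite (_ : (0 < i)%N); last by lia.
    by rewrite mulr0n; ring.
  have [Ei|/eqP ni] := eqVneq (j : nat) i.+1.
    rewrite (_ : (i == j :> nat) = false); last by lia.
    rewrite (_ : (j == i :> nat) = false); last by lia.
    rewrite (_ : (j == i.-1 :> nat) = false); last by lia.
    by rewrite mulr0n; ring.
  rewrite [j == i :> nat]eq_sym.
  have [Ei|/eqP nij] := eqVneq (i : nat) j.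
    rewrite -Ei mulr1n; have [E|/eqP E] := eqVneq (i : nat) i.-1; last by ring.
    by rewrite (_ : (0 < i)%N = false); [ring | lia].
  rewrite (_ : (j == i.-1 :> nat) = false); last by lia.
  by rewrite mulr0n; ring.
rewrite !big_split/= (sum_ord_pick _ (fun=> if (0 < i)%N then mu1 else 0)).
rewrite (sum_ord_pick _ (fun=> lam)) (sum_ord_pick _ (fun=> D)) ltn_ord /D.
have im : (i < m.+1)%N by [].
rewrite (_ : (i.-1 < m.+1)%N); last by lia.
rewrite ltnS; have [Ei|/eqP ni] := eqVneq (i : nat) 0%N.
  by rewrite Ei m1 /=; ring.
rewrite (_ : (0 < i)%N); last by lia.
have [->|/eqP nm] := eqVneq (i : nat) m; first by rewrite ltnn; ring.
by rewrite (_ : (i < m)%N); [ring | lia].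
Qed.

Lemma tandem_PF m (z : R) X r : (1 <= m)%N -> 0 < z < 1 ->
  (forall j, (j <= m)%N -> 0 < phase z j) -> boundary m z = 0 ->
  is_tandem_R lam mu1 mu2 X -> @is_PF_eigenvalue R m.+1 X r -> r = z.
Proof.
move=> m1 z01 x0 bd XP rP.
have Q2E : tandem_Q2 mu2 m *m const_mx 1 = const_mx mu2 :> 'cV_m.+1.
  by rewrite mul_scalar_mx; apply/matrixP => i j; rewrite !mxE mulr1.
apply: PF_eigenvalue_of_positive_kernel z01 _ (tandem_kernel m1 bd) XP rP.
- by move=> i j; rewrite !mxE; case: ifP => // _; exact: ltW.
- by move=> i j; rewrite !mxE; case: (i == j); rewrite ?mulr1n ?mulr0n// ltW.
- move=> i j ij; rewrite !mxE; case: ifP => _; first exact: ltW.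
  by rewrite -[_ == _ :> nat]/(i == j) (negPf ij).
- exact: tandem_generator.
- by move=> i; rewrite Q2E mxE.
- by move=> j; rewrite mxE x0// -ltnS.
Qed.

(** * Positive zeros of the boundary equation *)

Lemma phase_continuous j : continuous (phase^~ j).
Proof.
(* The recurrence has order two, so the induction carries two indices. *)
suff : continuous (phase^~ j) /\ continuous (phase^~ j.+1) by case.
have rate_cont : continuous out_rate.
  move=> z; apply: cvgD; first exact: cvg_cst.
  by apply: cvgMl_tmp; apply: cvgB; [exact: cvg_cst | exact: cvg_id].
elim: j => [|j [IH0 IH1]]; split => //.
- by move=> z; exact: cvg_cst.
- move=> z /=; apply: cvgMr_tmp; apply: cvgM; first exact: cvg_id.
  by apply: cvgB; [exact: rate_cont | exact: cvg_cst].
- move=> z; apply: cvgMr_tmp; apply: cvgB.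
    by apply: cvgM; [apply: cvgM; [exact: cvg_id | exact: rate_cont] |
                     exact: IH1].
  by apply: cvgM; [apply: cvgMr_tmp; exact: cvg_id | exact: IH0].
Qed.

Fixpoint phase_min (m : nat) (z : R) : R :=
  if m is k.+1 then Num.min (phase_min k z) (phase z m) else phase z 0.

(** One continuous function whose sign records positivity of the phase vector
    up to m and of the boundary term together; the intermediate value theorem
    is applied to it. *)
Definition margin (m : nat) (z : R) : R := Num.min (phase_min m z) (boundary m z).

Lemma margin_continuous m : continuous (margin m).
Proof.
have min_cont k : continuous (phase_min k).
  elim: k => [|k IH] z; first exact: cvg_cst.
  by apply: (@continuous_min _ _ (phase_min k) (phase^~ k.+1));
      [exact: IH | exact: phase_continuous].
move=> z; apply: (@continuous_min _ _ (phase_min m) (boundary m)).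
  exact: min_cont.
apply: cvgB; first by apply: cvgMl_tmp; exact: phase_continuous.
by apply: cvgM; [apply: cvgMr_tmp; exact: cvg_id | exact: phase_continuous].
Qed.

Lemma phase_min_gt0 m (z : R) :
  (forall j, (j <= m)%N -> 0 < phase z j) -> 0 < phase_min m z.
Proof.
elim: m => [|m IH] x0; first exact: (x0 0%N).
rewrite lt_min x0// andbT; apply: IH => j jm.
by rewrite x0// ltnW.
Qed.

Lemma phase_min_le m (z : R) j : (j <= m)%N -> phase_min m z <= phase z j.
Proof.
elim: m => [|m IH] /=; first by rewrite leqn0 => /eqP->.
by rewrite leq_eqVlt ltnS ge_min => /predU1P[->|/IH->//]; rewrite lexx orbT.
Qed.

(** At a zero of the margin everything is nonnegative.  If some x_{j+1} were 0
    with x_j > 0, the recurrence would give mu1 x_{j+2} = - z lam x_j < 0; this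
    contradicts x_{j+2} >= 0 for j + 1 < m and the boundary sign for j + 1 = m.
    So only the boundary term can vanish. *)
Lemma margin_root m (z : R) : 0 < z -> margin m z = 0 ->
  (forall j, (j <= m)%N -> 0 < phase z j) /\ boundary m z = 0.
Proof.
move=> z0 M0.
have bd0 : 0 <= boundary m z by rewrite -M0 ge_min lexx orbT.
have x_ge0 j : (j <= m)%N -> 0 <= phase z j.
  by move=> jm; rewrite -M0 ge_min phase_min_le.
have x0 j : (j <= m)%N -> 0 < phase z j.
  elim: j => [_|j IH jm]; first exact: ltr01.
  rewrite lt_neqAle x_ge0// andbT eq_sym; apply/eqP => xj.
  have xlt : mu1 * phase z j.+2 < 0.
    by rewrite phaseSS xj mulr0 sub0r oppr_lt0 !mulr_gt0// IH// ltnW.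
  move: jm; rewrite leq_eqVlt => /predU1P[E|jm].
    by move: bd0; rewrite /boundary -E xj mulr0 subr0 leNgt xlt.
  by have := x_ge0 _ jm; rewrite -(pmulr_rge0 _ mu1_gt0) leNgt xlt.
split=> //; have := phase_min_gt0 x0; move: M0; rewrite /margin.
have [_|//] := leP (phase_min m z) (boundary m z).
by move=> ->; rewrite ltxx.
Qed.

Lemma margin_IVT m (a c : R) : 0 < a < c -> margin m a <= 0 -> 0 < margin m c ->
  exists z, [/\ a <= z < c, forall j, (j <= m)%N -> 0 < phase z j
    & boundary m z = 0].
Proof.
move=> /andP[a0 ac] Ma Mc.
have [z] : exists2 z, z \in `[a, c]%R & margin m z = 0.
  apply: IVT; first exact: ltW.
    by apply: continuous_subspaceT => z; exact: margin_continuous.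
  by rewrite ge_min Ma le_max (ltW Mc) orbT.
rewrite in_itv/= => /andP[az zc] Mz.
have [x0 bd] := margin_root (lt_le_trans a0 az) Mz.
exists z; split=> //; rewrite az lt_neqAle zc andbT.
by apply/eqP => E; move: Mc; rewrite -E Mz ltxx.
Qed.

(** * Growth of the phase ratios *)

(** Characteristic polynomial of the recurrence.  The ratios
    w_j = x_{j+1} / x_j satisfy mu1 w_j (w_{j+1} - w_j) = - ratio_quad z w_j, so
    its sign decides whether they decrease. *)
Definition ratio_quad (z w : R) : R :=
  mu1 * w ^+ 2 - z * out_rate z * w + z * lam.

Lemma phase_geometric_lower (z w : R) : 0 < z -> 0 < w -> w <= phase z 1 ->
  ratio_quad z w <= 0 -> forall j, 0 < phase z j /\ w * phase z j <= phase z j.+1.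
Proof.
move=> z0 w0 w1 dw; elim=> [|j [xj xSj]].
  by split; [exact: ltr01 | rewrite [w * _]mulr1].
have xSj0 : 0 < phase z j.+1 by apply: lt_le_trans xSj; exact: mulr_gt0.
split=> //; rewrite -(ler_pM2l mu1_gt0) phaseSS -(ler_pM2l w0).
have h1 : z * lam * (w * phase z j) <= z * lam * phase z j.+1.
  by rewrite ler_wpM2l// mulr_ge0 ?ltW.
have : ratio_quad z w * phase z j.+1 <= 0 by exact: mulr_le0_ge0 dw (ltW xSj0).
by rewrite /ratio_quad; nra.
Qed.

(** A ratio w that starts below x_1 / x_0 and where the quadratic is
    nonpositive remains a lower bound of all ratios; the boundary term is then
    at least (mu1 w - z lam) x_m. *)
Lemma margin_gt0 (z w : R) : 0 < z -> 0 < w -> w <= phase z 1 ->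
  ratio_quad z w <= 0 -> z * lam < mu1 * w -> forall m, 0 < margin m z.
Proof.
move=> z0 w0 w1 dw zw m.
have x0 := phase_geometric_lower z0 w0 w1 dw.
rewrite /margin lt_min phase_min_gt0 => [|j _]; last by case: (x0 j).
have [xm xSm] := x0 m; rewrite /boundary subr_gt0.
apply: (@lt_le_trans _ _ (mu1 * (w * phase z m))); last by rewrite ler_pM2l.
by rewrite mulrA ltr_pM2r.
Qed.

(** Otherwise the ratios x_{j+1} / x_j would be positive, stay below the first
    one, and decrease by at least e / (mu1 w_0) at each step. *)
Lemma phase_le0 (z e : R) : 0 < z -> 0 < e ->
  (forall w, 0 < w <= phase z 1 -> e <= ratio_quad z w) ->
  exists k, phase z k <= 0.
Proof.
move=> z0 e0 de; apply: contrapT => /forallNP nx.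
have x0 j : 0 < phase z j by rewrite ltNge; apply/negP/nx.
pose w j := phase z j.+1 / phase z j.
have w0 j : 0 < w j by rewrite divr_gt0.
have w0E : w 0%N = phase z 1 by rewrite /w divr1.
pose d := e / (mu1 * w 0%N).
have d0 : 0 < d by rewrite divr_gt0// mulr_gt0.
have wS j : w j <= w 0%N -> w j.+1 <= w j - d.
  move=> wj; have dw : e <= ratio_quad z (w j) by apply: de; rewrite w0 -w0E.
  have wSj : mu1 * w j * w j.+1 = z * out_rate z * w j - z * lam.
    rewrite /w; have := phaseSS z j => rec.
    have -> : mu1 * (phase z j.+1 / phase z j) * (phase z j.+2 / phase z j.+1)
      = mu1 * phase z j.+2 / phase z j.
      by field; rewrite !gt_eqF.
    by rewrite rec; field; rewrite gt_eqF.
  have dE : d * (mu1 * w 0%N) = e by rewrite divfK// gt_eqF// mulr_gt0.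
  have mw : 0 < mu1 * w j by exact: mulr_gt0.
  rewrite -(ler_pM2l mw) wSj.
  have : d * (mu1 * w j) <= e by rewrite -dE !ler_pM2l.
  by move: dw; rewrite /ratio_quad; nra.
have wle j : w j <= w 0%N - d *+ j.
  elim: j => [|j IH]; first by rewrite subr0.
  have wj : w j <= w 0%N by apply: le_trans IH _; rewrite gerBl mulrn_wge0// ltW.
  by apply: le_trans (wS _ wj) _; rewrite mulrS; lra.
have := archi_boundP (ltW (divr_gt0 (w0 0%N) d0)).
set k := Num.bound _; rewrite ltr_pdivrMr// mulr_natl => wk.
by have := lt_le_trans (w0 k) (wle k); rewrite subr_gt0 ltNge (ltW wk).
Qed.

(** * Monotonicity and limit of the eigenvalues *)

Lemma tandem_PF_bracket m (a c : R) X r : (1 <= m)%N -> 0 < a < c -> c < 1 ->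
  margin m a <= 0 -> 0 < margin m c ->
  is_tandem_R lam mu1 mu2 X -> @is_PF_eigenvalue R m.+1 X r ->
  [/\ a <= r < c, forall j, (j <= m)%N -> 0 < phase r j & boundary m r = 0].
Proof.
move=> m1 ac c1 Ma Mc XP rP; have [z [azc x0 bd]] := margin_IVT ac Ma Mc.
suff -> : r = z by [].
apply: (tandem_PF m1 _ x0 bd XP rP).
case/andP: ac => a0 _; case/andP: azc => az zc.
by rewrite (lt_le_trans a0 az) (lt_trans zc c1).
Qed.

Lemma boundaryS m (z : R) : boundary m z = 0 ->
  boundary m.+1 z = (1 - z) * (z * mu2 - mu1) * phase z m.+1.
Proof.
move=> bd; rewrite /boundary phaseSS.
have -> : z * lam * phase z m = mu1 * phase z m.+1.
  by apply/esym/eqP; rewrite -subr_eq0 -/(boundary m z) bd.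
by rewrite /out_rate; ring.
Qed.

Section Limit.
Variables (Rmat : forall m : nat, 'M[R]_m.+1) (r : nat -> R) (c : R).
Hypothesis RmatP : forall m, (1 <= m)%N -> is_tandem_R lam mu1 mu2 (Rmat m).
Hypothesis rP : forall m, (1 <= m)%N -> is_PF_eigenvalue (Rmat m) (r m).
Hypotheses (c_gt0 : 0 < c) (c_lt1 : c < 1) (c_mu : c * mu2 < mu1).
Hypothesis margin_c : forall m, 0 < margin m c.

(** Starting point of the chain of zeros: mu1 B_1(z) / z tends to - lam mu1
    as z tends to 0. *)
Lemma boundary1_lt0 : exists2 a, 0 < a < c & boundary 1 a < 0.
Proof.
(* The denominator bounds the coefficient of z in mu1 B_1(z) / z. *)
pose q := lam * mu1 / ((mu1 + mu2) * (lam + mu2)).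
have D0 : 0 < (mu1 + mu2) * (lam + mu2) by rewrite mulr_gt0 ?addr_gt0.
have q0 : 0 < q by rewrite divr_gt0// mulr_gt0.
have q1 : q < 1.
  rewrite ltr_pdivrMr// mul1r mulrC ltr_pM ?ltW//.
    by rewrite ltrDl.
  by rewrite ltrDl.
exists (c * q); first by rewrite mulr_gt0//= gtr_pMr.
have qE : q * ((mu1 + mu2) * (lam + mu2)) = lam * mu1 by rewrite divfK// gt_eqF.
set z := c * q; have z0 : 0 < z by exact: mulr_gt0.
have z1 : z < 1 by rewrite mulr_ilt1 ?ltW.
have zs : z * ((mu1 + mu2) * (lam + mu2)) < lam * mu1.
  by rewrite /z -mulrA qE gtr_pMl// mulr_gt0.
rewrite /boundary phaseSS.
rewrite -(pmulr_rlt0 _ mu1_gt0).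
have -> : mu1 * (z * out_rate z * phase z 1 - z * lam * phase z 0
                 - z * lam * phase z 1)
    = z * ((out_rate z - lam) * (mu1 * phase z 1) - lam * mu1).
  by rewrite [phase z 0]/=; ring.
rewrite phase1 pmulr_rlt0// subr_lt0; apply: le_lt_trans zs.
rewrite mulrCA ler_pM2l//.
have z2 : 0 <= mu2 * (1 - z) by rewrite mulr_ge0 ?ltW// subr_gt0.
have z3 : 0 < mu2 * z by exact: mulr_gt0.
have outE : out_rate z - lam = mu1 + mu2 * (1 - z).
  by rewrite /out_rate; ring.
rewrite outE; apply: ler_pM; rewrite ?addr_ge0 ?(ltW mu1_gt0) ?(ltW lam_gt0)//.
  by lra.
by lra.
Qed.

(** The sign comes from B_{m+1} = (1 - z) (z mu2 - mu1) x_{m+1} at a zero of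
    B_m. *)
Lemma boundary_succ_lt0 m (z : R) : 0 < z < c -> 0 < phase z m ->
  boundary m z = 0 -> boundary m.+1 z < 0.
Proof.
move=> /andP[z0 zc] xm bd; rewrite (boundaryS bd).
have xSm : 0 < phase z m.+1.
  rewrite -(pmulr_rgt0 _ mu1_gt0) -(addrK (z * lam * phase z m) (mu1 * _)).
  by rewrite addrAC -/(boundary m z) bd add0r !mulr_gt0.
rewrite pmulr_llt0// pmulr_rlt0 ?subr_gt0 ?(lt_trans zc)//.
by rewrite subr_lt0 (lt_trans _ c_mu)// ltr_pM2r.
Qed.

Let margin_le0 m z : boundary m z < 0 -> margin m z <= 0.
Proof. by move=> bd; rewrite ge_min (ltW bd) orbT. Qed.

(** The zero for capacity m is a point of negative boundary for capacity m + 1,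
    which feeds the intermediate value argument there. *)
Lemma tandem_PF_root m : (1 <= m)%N ->
  [/\ 0 < r m < c, 0 < phase (r m) m & boundary m (r m) = 0].
Proof.
elim: m => // m IH m1.
have [a ac bda] : exists2 a, 0 < a < c & boundary m.+1 a < 0.
  case: m IH m1 => [_ _|m IH _]; first exact: boundary1_lt0.
  have [rc xm bd] := IH isT.
  by exists (r m.+1) => //; exact: boundary_succ_lt0 bd.
have [/andP[ar rc] x0 bd] := tandem_PF_bracket m1 ac c_lt1 (margin_le0 bda)
  (margin_c _) (RmatP m1) (rP m1).
by split; rewrite ?rc ?andbT ?x0//; case/andP: ac => a0 _; apply: lt_le_trans ar.
Qed.

Lemma tandem_PF_increasing m : (1 <= m)%N -> r m < r m.+1.
Proof.
move=> m1; have [rc xm bd] := tandem_PF_root m1.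
have bdS := boundary_succ_lt0 rc xm bd.
have [/andP[rr _] _ bd'] := tandem_PF_bracket (ltn0Sn m) rc c_lt1
  (margin_le0 bdS) (margin_c _) (RmatP (ltn0Sn m)) (rP (ltn0Sn m)).
rewrite lt_neqAle rr andbT; apply/eqP => E.
by move: bdS; rewrite E bd' ltxx.
Qed.

(** A nonpositive x_k(z) puts the zero for capacity k in [z, c), and the
    eigenvalues increase from there. *)
Lemma tandem_PF_cvg (c0 : R) : c0 < c ->
  (forall z, 0 < z -> c0 < z < c -> exists k, phase z k <= 0) ->
  r n @[n --> \oo] --> c.
Proof.
move=> c0c H; apply/cvgrPdist_lt => e e0.
pose b := Num.max 0 (Num.max c0 (c - e)).
have bc : b < c by rewrite !gt_max c_gt0 c0c ltrBlDr ltrDl.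
pose z := (b + c) / 2.
have bz : b < z by rewrite /z; lra.
have zc : z < c by rewrite /z; lra.
move: bz; rewrite !gt_max => /and3P[z0 c0z cez].
have [] := H z z0; first by rewrite c0z.
move=> k xk.
have k1 : (1 <= k)%N.
  by case: k xk => //; rewrite leNgt ltr01.
have Mk : margin k z <= 0.
  by rewrite ge_min (le_trans (phase_min_le _ (leqnn k)) xk).
have z0c : 0 < z < c by rewrite z0.
have [/andP[zr _] _ _] := tandem_PF_bracket k1 z0c c_lt1 Mk
  (margin_c _) (RmatP k1) (rP k1).
have rk n : (k <= n)%N -> r k <= r n.
  elim: n => [|n IH]; first by rewrite leqn0 => /eqP->.
  rewrite leq_eqVlt => /predU1P[->//|]; rewrite ltnS => kn.
  by rewrite (le_trans (IH kn))// ltW// tandem_PF_increasing// (leq_trans k1).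
near=> n.
have kn : (k <= n)%N by near: n; exists k.
have rkn := rk _ kn.
have [/andP[_ rc] _ _] := tandem_PF_root (leq_trans k1 kn).
by rewrite ger0_norm ?subr_ge0 ?ltW//; lra.
Unshelve. all: by end_near.
Qed.

End Limit.
End Tandem.

(** * The two candidate limits *)

(** With t = sqrt z, t tau(z) is a cubic in t that vanishes at s = sqrt eta:
    it equals (s - t) (C - mu2 (s^2 + s t + t^2)).  The second factor is positive
    because it decreases in t and already is positive at t = 1, where the cubic
    is - (sqrt mu1 - sqrt lam)^2. *)
Lemma tau_gt0 (R : realType) (lam mu1 mu2 eta z : R) :
  0 < lam -> lam < mu1 -> 0 < mu2 -> 0 < z < eta -> eta < 1 ->
  tau lam mu1 mu2 eta = 0 -> 0 < tau lam mu1 mu2 z.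
Proof.
move=> lam0 lm mu20 /andP[z0 ze] e1; rewrite /tau.
have mu10 := lt_trans lam0 lm.
have eta0 := lt_trans z0 ze.
have lm0 : 0 <= lam * mu1 by rewrite mulr_ge0 ?ltW.
rewrite !sqrtrM ?(ltW lam0)// !sqrtrV ?(ltW z0, ltW eta0)//.
set l := Num.sqrt lam; set u := Num.sqrt mu1.
set s := Num.sqrt eta; set t := Num.sqrt z.
have s0 : 0 < s by rewrite sqrtr_gt0.
have t0 : 0 < t by rewrite sqrtr_gt0.
have sE : eta = s ^+ 2 by rewrite sqr_sqrtr ?ltW.
have tE : z = t ^+ 2 by rewrite sqr_sqrtr ?ltW.
have lE : lam = l ^+ 2 by rewrite sqr_sqrtr ?ltW.
have uE : mu1 = u ^+ 2 by rewrite sqr_sqrtr ?ltW.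
have l0 : 0 < l by rewrite sqrtr_gt0.
have lu : l < u by rewrite ltr_sqrt.
have ts : t < s by rewrite ltr_sqrt.
have s1 : s < 1 by rewrite -sqrtr1 ltr_sqrt.
set C := lam + mu1 + mu2.
have -> : - lam - mu1 - mu2 * (1 - eta) + 2 * (l * u / s)
    = (2 * l * u - C * s + mu2 * s ^+ 3) / s.
  by rewrite sE /C; field; rewrite gt_eqF.
have -> : - lam - mu1 - mu2 * (1 - z) + 2 * (l * u / t)
    = (2 * l * u - C * t + mu2 * t ^+ 3) / t.
  by rewrite tE /C; field; rewrite gt_eqF.
move=> /eqP; rewrite mulf_eq0 invr_eq0 (gt_eqF s0) orbF => /eqP root_s.
rewrite divr_gt0//.
have -> : 2 * l * u - C * t + mu2 * t ^+ 3
    = (s - t) * (C - mu2 * (s ^+ 2 + s * t + t ^+ 2)).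
  by rewrite -[LHS]subr0 -root_s; ring.
have at1 : 0 < (1 - s) * (C - mu2 * (1 + s + s ^+ 2)).
  have -> : (1 - s) * (C - mu2 * (1 + s + s ^+ 2)) = (u - l) ^+ 2.
    by rewrite -[LHS]subr0 -root_s /C lE uE; ring.
  by rewrite exprn_gt0// subr_gt0.
have {}at1 : 0 < C - mu2 * (1 + s + s ^+ 2).
  by move: at1; rewrite pmulr_rgt0// subr_gt0.
rewrite mulr_gt0 ?subr_gt0//; rewrite subr_gt0 in at1; apply: le_lt_trans at1.
by rewrite ler_pM2l//; nra.
Qed.

Section Limits.
Variables (R : realType) (lam mu1 mu2 : R).
Hypotheses (lam_gt0 : 0 < lam) (mu1_gt0 : 0 < mu1) (mu2_gt0 : 0 < mu2).
Hypotheses (lm1 : lam < mu1) (lm2 : lam < mu2).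

Lemma tauE (z : R) : tau lam mu1 mu2 z =
  2 * Num.sqrt (lam * mu1 / z) - out_rate lam mu1 mu2 z.
Proof. by rewrite /tau /out_rate; ring. Qed.

Section Eta.
Variable eta : R.
Hypotheses (eta_gt0 : 0 < eta) (eta_lt1 : eta < 1).
Hypothesis eta_zero : tau lam mu1 mu2 eta = 0.

(** At lam / mu2 the function tau is - (sqrt mu1 - sqrt mu2)^2 <= 0, so this
    point is not to the left of eta. *)
Lemma eta_le_rho : eta * mu2 <= lam.
Proof.
rewrite -ler_pdivlMr// leNgt; apply/negP => rho_lt.
have rho_range : 0 < lam / mu2 < eta by rewrite divr_gt0.
have := tau_gt0 lam_gt0 lm1 mu2_gt0 rho_range eta_lt1 eta_zero.
rewrite /tau invfM invrK mulrA [_ / lam]mulrC !mulrA mulVf ?gt_eqF// mul1r.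
rewrite sqrtrM ?ltW//; set u := Num.sqrt mu1; set v := Num.sqrt mu2.
have uE : mu1 = u ^+ 2 by rewrite sqr_sqrtr ?ltW.
have vE : mu2 = v ^+ 2 by rewrite sqr_sqrtr ?ltW.
have -> : - lam - mu1 - mu2 * (1 - lam / mu2) + 2 * (u * v) = - (u - v) ^+ 2.
  have -> : mu2 * (1 - lam / mu2) = mu2 - lam by field; rewrite gt_eqF.
  by rewrite uE vE; ring.
by rewrite ltNge oppr_le0 sqr_ge0.
Qed.

(** Let g = sqrt (lam mu1 / eta).  At eta the quadratic has the double root
    w = eta g / mu1, and mu1 <= mu2 gives mu1 <= g, which places w below the initial ratio and makes the
    boundary term positive. *)
Lemma margin_eta_gt0 m : mu1 <= mu2 -> 0 < margin lam mu1 mu2 m eta.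
Proof.
move=> mu12; pose g := Num.sqrt (lam * mu1 / eta).
have g0 : 0 < g by rewrite sqrtr_gt0 divr_gt0 ?mulr_gt0.
have gE : eta * g ^+ 2 = lam * mu1.
  by rewrite sqr_sqrtr ?divr_ge0 ?mulr_ge0 ?ltW// mulrC divfK// gt_eqF.
have outE : out_rate lam mu1 mu2 eta = 2 * g.
  by apply/eqP; rewrite eq_sym -subr_eq0 -tauE eta_zero.
have w0 : 0 < eta * g / mu1 by rewrite divr_gt0 ?mulr_gt0.
have wE : mu1 * (eta * g / mu1) = eta * g by rewrite mulrC divfK// gt_eqF.
have mu_g : mu1 <= g.
  rewrite leNgt; apply/negP => g_mu.
  have : eta * g ^+ 2 < eta * mu1 ^+ 2 by rewrite ltr_pM2l// ltrXn2r// ltW.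
  rewrite gE expr2 mulrA ltr_pM2r// ltNge (le_trans _ eta_le_rho)//.
  by rewrite ler_pM2l.
apply: (margin_gt0 lam_gt0 mu1_gt0 _ w0) => //.
- rewrite -(ler_pM2l mu1_gt0) phase1// wE ler_pM2l//.
  by move: outE mu_g; rewrite /out_rate; lra.
- rewrite /ratio_quad outE -(ler_pM2l mu1_gt0) mulr0 le_eqVlt; apply/orP; left.
  apply/eqP; transitivity ((mu1 * (eta * g / mu1)) ^+ 2
    - 2 * eta * g * (mu1 * (eta * g / mu1)) + eta * (lam * mu1)); first by ring.
  by rewrite wE -gE; ring.
- by rewrite wE ltr_pM2l// (lt_le_trans lm1).
Qed.

(** Left of eta the quadratic has negative discriminant, so it is bounded below
    by its minimum e > 0. *)
Lemma phase_le0_lt_eta z : 0 < z < eta -> exists k, phase lam mu1 mu2 z k <= 0.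
Proof.
move=> z0e; have /andP[z0 ze] := z0e.
have := tau_gt0 lam_gt0 lm1 mu2_gt0 z0e eta_lt1 eta_zero.
rewrite tauE subr_gt0; set S := out_rate _ _ _ z => S_lt.
have S0 : 0 < S.
  by rewrite /S /out_rate !addr_gt0// mulr_gt0// subr_gt0 (lt_trans ze).
have disc : z * S ^+ 2 < 4 * (lam * mu1).
  have -> : 4 * (lam * mu1) = z * (2 * Num.sqrt (lam * mu1 / z)) ^+ 2.
    rewrite exprMn sqr_sqrtr ?divr_ge0 ?mulr_ge0 ?ltW//.
    by field; rewrite gt_eqF.
  by rewrite ltr_pM2l// ltrXn2r// ltW.
pose e := z * (4 * (lam * mu1) - z * S ^+ 2) / (4 * mu1).
apply: (@phase_le0 _ lam mu1 mu2 mu1_gt0 _ e) => //.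
  by rewrite /e divr_gt0 ?mulr_gt0// subr_gt0.
move=> w _; rewrite -subr_ge0 /ratio_quad -/S.
have -> : mu1 * w ^+ 2 - z * S * w + z * lam - e
    = mu1 * (w - z * S / (2 * mu1)) ^+ 2.
  by rewrite /e; field; rewrite gt_eqF.
by rewrite mulr_ge0 ?sqr_ge0// ltW.
Qed.

End Eta.

(** At z = lam / mu2 the phase vector is geometric with ratio lam / mu1, as in
    the product-form network without capacity constraint. *)
Lemma margin_rho_gt0 m : 0 < margin lam mu1 mu2 m (lam / mu2).
Proof.
set rho := lam / mu2.
have rhoE : rho * mu2 = lam by rewrite divfK// gt_eqF.
have rho0 : 0 < rho by rewrite divr_gt0.
have rho1 : rho < 1 by rewrite ltr_pdivrMr// mul1r.
have w0 : 0 < lam / mu1 by rewrite divr_gt0.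
have wE : mu1 * (lam / mu1) = lam by rewrite mulrC divfK// gt_eqF.
have lmE : lam + mu2 * (1 - rho) = mu2.
  by rewrite mulrBr mulr1 [mu2 * rho]mulrC rhoE; ring.
apply: (margin_gt0 lam_gt0 mu1_gt0 _ w0) => //.
- by rewrite -(ler_pM2l mu1_gt0) phase1// wE lmE rhoE.
- rewrite /ratio_quad /out_rate -(ler_pM2l mu1_gt0) mulr0 le_eqVlt.
  apply/orP; left; rewrite [lam + mu1 + _]addrAC lmE.
  apply/eqP; transitivity ((mu1 * (lam / mu1)) ^+ 2
    - (rho * mu2 + rho * mu1) * (mu1 * (lam / mu1)) + mu1 * rho * lam).
    by ring.
  by rewrite wE rhoE; ring.
- by rewrite wE gtr_pMl.
Qed.

(** On this interval the initial ratio w_1 = x_1 / x_0 lies left of the vertex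
    of the quadratic and its value there, e = z (1 - z) (lam - z mu2), is
    positive; the quadratic decreases up to w_1.  The interval is nonempty
    exactly when mu2 < mu1. *)
Lemma phase_le0_near_rho z : 0 < z ->
  1 - (mu1 - lam) / mu2 < z < lam / mu2 -> exists k, phase lam mu1 mu2 z k <= 0.
Proof.
set c0 := 1 - _; move=> z0 /andP[c0z zrho].
have c0E : c0 * mu2 = mu2 - (mu1 - lam).
  by rewrite mulrBl mul1r divfK// gt_eqF.
have zmu : z * mu2 < lam by rewrite -ltr_pdivlMr.
have z1 : z < 1 by rewrite (lt_trans zrho)// ltr_pdivrMr// mul1r.
have c0mu : mu2 - (mu1 - lam) < z * mu2 by rewrite -c0E ltr_pM2r.
pose e := z * (1 - z) * (lam - z * mu2).
apply: (@phase_le0 _ lam mu1 mu2 mu1_gt0 _ e) => //.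
  by rewrite /e !mulr_gt0 ?subr_gt0.
move=> w /andP[w0]; set w1 := phase _ _ _ _ 1 => ww1.
have mw1 : mu1 * w1 = z * (lam + mu2 * (1 - z)) by exact: phase1.
rewrite -subr_ge0 /ratio_quad /out_rate.
have -> : mu1 * w ^+ 2 - z * (lam + mu1 + mu2 * (1 - z)) * w + z * lam - e
  = (w1 - w) * (z * mu1 - mu1 * w).
  have -> : (w1 - w) * (z * mu1 - mu1 * w)
      = mu1 * w1 * z - (mu1 * w1) * w - w * z * mu1 + mu1 * w ^+ 2 by ring.
  by rewrite mw1 /e; ring.
rewrite mulr_ge0 ?subr_ge0//.
rewrite (@le_trans _ _ (mu1 * w1))// ?ler_pM2l// mw1 ler_pM2l//.
by move: c0mu; nra.
Qed.

End Limits.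

Theorem corollary5p5 (R : realType) (lam mu1 mu2 : R)
  (lam_gt0 : 0 < lam) (mu1_gt0 : 0 < mu1) (mu2_gt0 : 0 < mu2)
  (lam_lt : lam < Num.min mu1 mu2)
  (Rmat : forall m : nat, 'M[R]_m.+1)
  (RmatP : forall m : nat, (1 <= m)%N -> is_tandem_R lam mu1 mu2 (Rmat m))
  (r : nat -> R)
  (rP : forall m : nat, (1 <= m)%N -> is_PF_eigenvalue (Rmat m) (r m))
  (eta : R) (eta_gt0 : 0 < eta) (eta_lt1 : eta < 1)
  (eta_zero : tau lam mu1 mu2 eta = 0) :
  (mu1 <= mu2 ->
     (forall m : nat, (1 <= m)%N -> r m < r m.+1) /\
     (r n @[n --> \oo] --> eta)) /\
  (mu2 < mu1 ->
     (forall m : nat, (1 <= m)%N -> r m < r m.+1) /\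
     (r n @[n --> \oo] --> lam / mu2)).
Proof.
move: lam_lt; rewrite lt_min => /andP[lm1 lm2].
split=> mu12.
- have eta_mu : eta * mu2 < mu1.
    by rewrite (le_lt_trans _ lm1)// (eta_le_rho lam_gt0 mu1_gt0 mu2_gt0).
  have margin_eta m : 0 < margin lam mu1 mu2 m eta by exact: margin_eta_gt0.
  split; first exact: (tandem_PF_increasing lam_gt0 mu1_gt0 mu2_gt0
    RmatP rP eta_gt0).
  apply: (tandem_PF_cvg lam_gt0 mu1_gt0 mu2_gt0 RmatP rP eta_gt0 eta_lt1
    eta_mu margin_eta eta_gt0) => z z0 /andP[_ ze].
  by apply: (@phase_le0_lt_eta _ _ _ _ lam_gt0 mu1_gt0 mu2_gt0 lm1 eta);
    rewrite ?z0.
- have rho0 : 0 < lam / mu2 by rewrite divr_gt0.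
  have rho1 : lam / mu2 < 1 by rewrite ltr_pdivrMr// mul1r.
  have rho_mu : lam / mu2 * mu2 < mu1 by rewrite divfK// gt_eqF.
  have margin_rho m : 0 < margin lam mu1 mu2 m (lam / mu2).
    exact: margin_rho_gt0.
  split; first exact: (tandem_PF_increasing lam_gt0 mu1_gt0 mu2_gt0
    RmatP rP rho0).
  have c0_lt : 1 - (mu1 - lam) / mu2 < lam / mu2.
    by rewrite ltrBlDr -mulrDl addrC subrK ltr_pdivlMr// mul1r.
  apply: (tandem_PF_cvg lam_gt0 mu1_gt0 mu2_gt0 RmatP rP rho0 rho1 rho_mu
    margin_rho c0_lt) => z z0 z_range.
  exact: phase_le0_near_rho.
Qed.
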